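(* Let $G$ be a countable group, and let $G\curvearrowright X$ be a faithful extreme boundary action, where $X$ is Hausdorff. Then: (i) if $G_x$ is amenable for some $x\in X$, then $\mathcal{A}_G=\mathcal{S}_G(X)$; (ii) if $G_x$ is non-amenable for all $x\in X$, then $\mathcal{A}_G$ is trivial.
   Context: Actions are by homeomorphisms; $G_x$ is the stabilizer of $x$. A subset $Y\subset X$ is compressible if there exists $x\in X$ such that for every open $U\subset X$ containing $x$ there is $g\in G$ with $g(Y)\subset U$. The action is extremely proximal if every closed $C\subset X$ with $C\neq X$ is compressible; minimal if every orbit is dense. An extreme boundary action is an action on a compact space that is minimal and extremely proximal. $\mathrm{Sub}(G)$ is the space of subgroups of $G$ with the topology induced from the product topology on $\{0,1\}^G$, on which $G$ acts by conjugation. A uniformly recurrent subgroup (URS) is a (non-empty) closed minimal $G$-invariant subset of $\mathrm{Sub}(G)$; the trivial URS is $\{\{1\}\}$; a URS is amenable if all its elements are amenable groups. For URS's $\mathcal{H},\mathcal{K}$, $\mathcal{H}\preccurlyeq\mathcal{K}$ means that there exist $H\in\mathcal{H}$ and $K\in\mathcal{K}$ with $H\le K$; this is a partial order on the set of URS's of $G$. The Furstenberg URS $\mathcal{A}_G$ is the unique amenable URS of $G$ such that $\mathcal{H}\preccurlyeq\mathcal{A}_G$ for every amenable URS $\mathcal{H}$ of $G$ (it exists for every countable group). With $X_0$ the set of continuity points of the map $X\to\mathrm{Sub}(G)$, $x\mapsto G_x$, the stabilizer URS $\mathcal{S}_G(X)$ of a minimal action on a compact space $X$ is the closure in $\mathrm{Sub}(G)$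 of $\{G_x : x\in X_0\}$, which is a URS.
   Formalization: The formal theorem assumes that X does not have exactly two points; for the group of order two swapping the two points of a discrete X, all stated hypotheses hold but the Furstenberg URS is {G} while the stabilizer URS is trivial, so (i) fails. *)

(* Defs.v *)
From HB Require Import structures.
From mathcomp Require Import all_boot all_order all_algebra.
From mathcomp Require Import all_classical all_reals.
From mathcomp Require Import topology.

Set Implicit Arguments.
Unset Strict Implicit.
Unset Printing Implicit Defensive.

Import Algebra.
Local Open Scope classical_set_scope.
Local Open Scope group_scope.

Record homeo_action (G : groupType) (X : topologicalType) := HomeoAction {
  act :> G -> X -> X;
  act1 : forall x, act 1 x = x;
  actM : forall g h x, act (g * h) x = act g (act h x);
  act_continuous : forall g, continuous (act g)
}.

Section Actions.
Context {G : groupType} {X : topologicalType} (a : homeo_action G X).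

Definition faithful_action := forall g, (forall x, a g x = x) -> g = 1.

Definition minimal_action := forall x, dense (range (fun g => a g x)).

Definition compressible (Y : set X) :=
  exists x : X, forall U : set X, open U -> U x ->
    exists g : G, a g @` Y `<=` U.

Definition extremely_proximal :=
  forall C : set X, closed C -> C <> setT -> compressible C.

Definition extreme_boundary_action :=
  [/\ compact [set: X], minimal_action & extremely_proximal].

End Actions.

Definition subgroups (G : groupType) : set {ptws G -> bool} :=
  [set H | group_closed (H : {pred G})].
Arguments subgroups G : clear implicits.

(* As a [set_type], it carries the topology induced from {ptws G -> bool}. *)
Definition subgroup (G : groupType) : topologicalType := set_type (subgroups G).

Section Subgroups.
Context {G : groupType}.

Definition carrier (H : subgroup G) : set G := [set g | (set_val H : G -> bool) g].

Lemma conj_subgroup (g : G) (H : subgroup G) :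
  subgroups G (fun x => (set_val H : G -> bool) (x ^ g)).
Proof.
have [H1 HF] : group_closed (set_val H : {pred G}) := set_valP H.
split=> [|x y Hx Hy]; rewrite unfold_in /=; first by rewrite conj1g.
by rewrite conjMg conjVg; apply: HF.
Qed.

(* gHg^-1: x ^ g is g^-1 * (x * g). *)
Definition conj_sub (g : G) (H : subgroup G) : subgroup G := 
  SigSub (mem_set (conj_subgroup g H)).

Lemma trivial_subgroup : subgroups G (fun x => x == 1).
Proof.
split=> [|x y /eqP-> /eqP->]; rewrite unfold_in /=; first exact/eqP.
by rewrite mulgV.
Qed.

Definition trivial_sub : subgroup G := SigSub (mem_set trivial_subgroup).

Definition conj_invariant (K : set (subgroup G)) :=
  forall g H, K H -> K (conj_sub g H).

Definition is_urs (K : set (subgroup G)) :=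
  [/\ K !=set0, closed K, conj_invariant K &
    forall L : set (subgroup G), L !=set0 -> closed L -> conj_invariant L ->
      L `<=` K -> L = K].

Definition trivial_urs : set (subgroup G) := [set trivial_sub].

Definition urs_le (H K : set (subgroup G)) :=
  exists A B : subgroup G, [/\ H A, K B & carrier A `<=` carrier B].

Local Open Scope ring_scope.

(* H has a left-invariant finitely additive probability measure defined on all
   of its subsets; the values of mu on other subsets of G are irrelevant. *)
Definition amenable (R : realType) (H : subgroup G) :=
  exists mu : set G -> R,
    [/\ forall A, A `<=` carrier H -> 0 <= mu A,
        mu (carrier H) = 1,
        forall A B, A `<=` carrier H -> B `<=` carrier H ->
          A `&` B = set0 -> mu (A `|` B) = mu A + mu B &
        forall h A, carrier H h -> A `<=` carrier H ->
          mu ((fun x => (h * x)%g) @` A) = mu A].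

Definition amenable_urs (R : realType) (K : set (subgroup G)) :=
  is_urs K /\ forall H, K H -> amenable R H.

Definition is_furstenberg_urs (R : realType) (K : set (subgroup G)) :=
  amenable_urs R K /\ forall L, amenable_urs R L -> urs_le L K.

End Subgroups.

(* Definite description. The default set0 is not a URS, so equating
   furstenberg_urs with a nonempty set also asserts that it exists. *)
Definition furstenberg_urs (R : realType) (G : groupType) : set (subgroup G) :=
  xget set0 [set K : set (subgroup G) | is_furstenberg_urs R K].
Arguments furstenberg_urs R G : clear implicits.

Section Stabilizers.
Context {G : groupType} {X : topologicalType} (a : homeo_action G X).

Lemma stab_subgroup (x : X) : subgroups G (fun g => a g x == x).
Proof.
split=> [|g h /eqP gx /eqP hx]; rewrite unfold_in /=; first by rewrite act1.
have h'x : a h^-1 x = x by rewrite -[X in a _ X]hx -actM mulVg act1.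
by rewrite actM h'x gx.
Qed.

Definition stab (x : X) : subgroup G := SigSub (mem_set (stab_subgroup x)).

Definition stabilizer_urs : set (subgroup G) :=
  closure (stab @` [set x | {for x, continuous stab}]).

End Stabilizers.

(* Main.v *)
Require Import Defs.
From mathcomp Require Import all_boot all_order all_algebra.
From mathcomp Require Import all_classical all_reals.
From mathcomp Require Import topology normedtype.
From mathcomp Require Import lra.

Set Implicit Arguments.
Unset Strict Implicit.
Unset Printing Implicit Defensive.

Import Algebra.
Import Order.TTheory GRing.Theory Num.Theory numFieldNormedType.Exports.
Local Open Scope classical_set_scope.
Local Open Scope group_scope.

(** Throughout, amenability is used in the form of a finitely additive
    probability measure on all subsets of the ambient group, invariant under
    left translation by the subgroup ([amenableP]). In this form it passes to
    smaller sets and along maps such as conjugation or quotients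
    ([has_mean_push]), can be checked on finite sets ([has_mean_finite]), and is
    a closed condition in the space of subgroups ([amenable_closure]).

    The theorem rests on two facts about an amenable URS [L].

    First, every point stabilizer contains a member of [L]
    ([amenable_urs_below_stab]). An invariant mean for a member of [L], pushed
    to the space, leaves some nonempty open set with mean less than one half,
    hence its closed complement [C] with mean more than one half. Extreme
    proximality compresses [C] into a small neighborhood of [x]. If no member of
    [L] fixed [x], compactness of [L] would provide finitely many elements that
    move this neighborhood off itself and one of which lies in each member of
    [L]; conjugating back, a member of [L] would move [C] off itself, which its
    mean forbids.

    Second, if [L] is nontrivial then the rigid stabilizer of some nonempty open
    set is amenable ([rist_mean_of_nontrivial_urs]), again by a compactness and
    conjugation argument. By extreme proximality, finitely many elements that
    fix a neighborhood of [x] are conjugate into this rigid stabilizer; so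
    [stab a x] is amenable whenever [x] is a continuity point of the stabilizer
    map ([amenable_stab_of_rist]).

    If some stabilizer is amenable, then all members of the stabilizer URS are,
    being limits of its conjugates, and by the first fact the stabilizer URS
    lies above each amenable URS. If no stabilizer is amenable then, since
    continuity points exist by a Baire argument, the second fact leaves the
    trivial URS as the only amenable one. Antisymmetry of the order on URSs
    ([urs_le_antisym]) identifies the Furstenberg URS in both cases.

    Both facts use three distinct points. A space without them and without
    exactly two points is empty or a singleton, and then faithfulness makes the
    group trivial. *)

(** * Invariant finitely additive means *)

Section Means.
Context {R : realType}.
Local Open Scope ring_scope.

Definition mean {T : Type} (m : set T -> R) :=
  [/\ forall A, 0 <= m A, m setT = 1 &
      forall A B, A `&` B = set0 -> m (A `|` B) = m A + m B].

Lemma mean_le T (m : set T -> R) A B : mean m -> A `<=` B -> m A <= m B.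
Proof.
move=> [m0 _ mU] AB; have -> : B = A `|` (B `\` A) by rewrite setDUK.
by rewrite mU ?lerDl // setDE setICA setICr setI0.
Qed.

Lemma mean_le1 T (m : set T -> R) A : mean m -> m A <= 1.
Proof. by move=> mm; have [_ <- _] := mm; exact: mean_le. Qed.

Lemma mean_preimage T U (f : T -> U) (m : set T -> R) :
  mean m -> mean (fun A : set U => m (f @^-1` A)).
Proof.
move=> [m0 m1 mU]; split=> [A||A B AB]; first exact: m0.
  by rewrite preimage_setT.
by rewrite preimage_setU mU // -preimage_setI AB preimage_set0.
Qed.

Context {G : groupType}.

(** Invariance is only asked for the elements of an arbitrary set [S], but the
    mean lives on all subsets of the ambient group: means on different
    subgroups can thus be compared and transported without restricting them. *)
Definition has_mean (S : set G) := exists m : set G -> R,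
  mean m /\ forall s A, S s -> m [set x | A (s * x)%g] = m A.

Lemma has_meanS (S T : set G) : T `<=` S -> has_mean S -> has_mean T.
Proof. by move=> TS [m [mm mS]]; exists m; split=> // s A /TS; exact: mS. Qed.

(** Push the mean forward by [F]. Conjugation, retractions onto a subgroup and
    quotient maps are all instances. *)
Lemma has_mean_push (S T : set G) (F : G -> G) :
  (forall t, T t -> exists2 s, S s & forall x, F (s * x)%g = (t * F x)%g) ->
  has_mean S -> has_mean T.
Proof.
move=> FP [m [mm mS]]; exists (fun A => m (F @^-1` A)).
split=> [|t A /FP[s Ss Fs]]; first exact: mean_preimage.
rewrite -[RHS](mS s) //; congr m; apply/funext => x.
by rewrite /preimage /mkset /= Fs.
Qed.

Lemma has_mean_conj (S T : set G) (g : G) :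
  (forall t, T t -> S (t ^ g)%g) -> has_mean S -> has_mean T.
Proof.
move=> ST; apply: (@has_mean_push _ _ (fun x => g * x)%g) => t /ST Ht.
by exists (t ^ g)%g => // x; rewrite conjgE !mulgA mulgV mul1g.
Qed.

(** Each right coset [H x] gets a representative, and an element of the coset
    is sent to its quotient by that representative. *)
Lemma retraction (H : subgroup G) : exists f : G -> G,
  (forall x, carrier H (f x)) /\
  forall h x, carrier H h -> f (h * x)%g = (h * f x)%g.
Proof.
have [H1 HF] : group_closed (set_val H : {pred G}) := set_valP H.
have HM := group_closedM (conj H1 HF); have HV := group_closedV (conj H1 HF).
pose r x := xget 1%g [set y | carrier H (y * x^-1)%g].
have rP x : carrier H (r x * x^-1)%g.
  apply: (@xgetPex _ 1%g [set y | carrier H (y * x^-1)%g]).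
  by exists x; rewrite /= mulgV.
have rM h x : carrier H h -> r (h * x)%g = r x.
  move=> Hh; rewrite /r; congr xget; apply/seteqP; split=> y /= Hy.
    have -> : (y * x^-1 = (y * (h * x)^-1) * h)%g by rewrite invgM !mulgA mulgVK.
    exact: HM.
  by rewrite invgM mulgA; apply: HM => //; apply: HV.
exists (fun x => x * (r x)^-1)%g; split=> [x|h x Hh].
  by have := HV _ (rP x); rewrite invgM invgK.
by rewrite rM // mulgA.
Qed.

Lemma amenableP (H : subgroup G) : amenable R H <-> has_mean (carrier H).
Proof.
have [H1 HF] : group_closed (set_val H : {pred G}) := set_valP H.
have HM := group_closedM (conj H1 HF); have HV := group_closedV (conj H1 HF).
split=> [[mu [mu0 mu1 muU muM]]|[m [[m0 m1 mU] mM]]].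
  exists (fun A => mu (A `&` carrier H)); split; first split.
  - by move=> A; apply: mu0.
  - by rewrite setTI.
  - by move=> A B AB; rewrite setIUl muU // setIACA AB set0I.
  move=> s A Hs; rewrite -[LHS](muM s) //; congr mu.
  apply/seteqP; split=> [_ [x [Ax Hx] <-]|x [Ax Hx]].
    by split=> //; exact: HM.
  exists (s^-1 * x)%g; last by rewrite mulVKg.
  by split; [rewrite /= mulVKg|apply: HM => //; exact: HV].
have [f [fH fM]] := retraction H.
exists (fun A => m (f @^-1` A)); split=> [A _||A B _ _ AB|h A Hh AH].
- exact: m0.
- by rewrite -m1; congr m; apply/seteqP; split=> // x _; exact: fH.
- by rewrite preimage_setU mU // -preimage_setI AB preimage_set0.
rewrite -(mM h^-1%g (f @^-1` A)); last exact: HV.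
congr m; apply/seteqP; split=> x /=.
  by move=> [y Ay yx]; rewrite fM -?yx ?mulKg //; exact: HV.
by rewrite fM; [move=> Afx; exists (h^-1 * f x)%g; rewrite ?mulVKg|exact: HV].
Qed.

(** Along an ultrafilter on finite lists that contains the upward cone of each
    list, the means invariant under longer and longer lists converge on every
    set, since they take values in the compact interval [[0, 1]]. *)
Lemma has_mean_finite (S : set G) :
  (forall l : seq G, (forall s, s \in l -> S s) -> has_mean [set` l]) ->
  has_mean S.
Proof.
move=> SP.
pose l_ (l : seq G) := [seq x <- l | `[< S x >]].
have /choice[M MP] : forall l, exists m : set G -> R,
    mean m /\ forall s A, [set` l_ l] s -> m [set x | A (s * x)%g] = m A.
  by move=> l; apply: SP => s; rewrite mem_filter => /andP[/asboolP].
pose D := (setT : set (seq G)).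
pose B (l : seq G) : set (seq G) := [set l' | {subset l <= l'}].
have FF : ProperFilter (filter_from D B).
  apply: filter_from_proper; last by move=> l _; exists l => /=.
  apply: filter_from_filter; first by exists [::].
  move=> l l' _ _; exists (l ++ l') => // l'' sub; split=> x xl; apply: sub;
    by rewrite mem_cat xl ?orbT.
have [U [UU BU]] := ultraFilterLemma FF.
have UP := @ultra_proper _ _ UU.
have cvM A : cvg (M^~ A @ U).
  have [|x [_ clx]] := @segment_compact R 0 1 (M^~ A @ U).
    suff: U ((M^~ A) @^-1` `[0, 1]) by [].
    apply: filterS filterT => l _ /=; have [ml _] := MP l; have [m0 _ _] := ml.
    by rewrite in_itv /= m0 mean_le1.
  apply/cvg_ex; exists x => N Nx.
  have [//|UN] := in_ultra_setVsetC ((M^~ A) @^-1` N) UU.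
  by have [y []] := clx (~` N) N UN Nx.
exists (fun A => lim (M^~ A @ U)); split; first split.
- move=> A; apply: limr_ge; first exact: cvM.
  by apply: nearW => l; have [[]] := MP l.
- rewrite (_ : M^~ setT = cst 1) ?lim_cst //.
  by apply/funext => l; have [[]] := MP l.
- move=> A A' AA'; rewrite -limD; try exact: cvM.
  by congr (lim (_ @ U)); apply/funext => l; have [[_ _ ->]] := MP l.
move=> s A Ss; apply: cvg_lim => //.
apply: cvg_trans (cvM A); apply: near_eq_cvg.
apply: BU; exists [:: s] => // l /(_ s (mem_head _ _)) sl.
by have [_ ->//] := MP l; rewrite /= mem_filter asboolT.
Qed.

End Means.
(** * The space of subgroups *)

Lemma filter_seq (I : eqType) (T : Type) (F : set_system T) (FF : Filter F)
    (s : seq I) (P : I -> T -> Prop) :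
  (forall i, i \in s -> F [set y | P i y]) ->
  F [set y | forall i, i \in s -> P i y].
Proof.
elim: s => [|i s IHs] Ps; first exact: filterE.
have Ps' := IHs (fun j js => Ps j (mem_behead (s := i :: s) js)).
apply: filterS2 (Ps i (mem_head _ _)) Ps' => y Pi Pj j.
by rewrite in_cons => /orP[/eqP->|/Pj].
Qed.

Section SpaceOfSubgroups.
Context {G : groupType}.
Implicit Types (H K : subgroup G) (F : seq G).

Lemma carrier1 H : carrier H 1.
Proof. by have [] := set_valP H. Qed.

Lemma carrierM H x y : carrier H x -> carrier H y -> carrier H (x * y).
Proof. by move=> Hx Hy; exact: (group_closedM (set_valP H)). Qed.

Lemma carrierV H x : carrier H x -> carrier H x^-1.
Proof. by move=> Hx; exact: (group_closedV (set_valP H)). Qed.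

Lemma carrier_inj H K : (forall g, carrier H g <-> carrier K g) -> H = K.
Proof.
move=> HK; apply: val_inj; apply/funext => g; apply/idP/idP => Hg.
  by have [/(_ Hg)] := HK g.
by have [_ /(_ Hg)] := HK g.
Qed.

Lemma carrier_conj g H x : carrier (conj_sub g H) x <-> carrier H (x ^ g).
Proof. by []. Qed.

Lemma carrier_trivial x : carrier (trivial_sub : subgroup G) x <-> x = 1.
Proof. by split=> [/eqP|->]//; exact: eqxx. Qed.

Definition agree F H K := forall g, g \in F -> (carrier H g <-> carrier K g).

Lemma agree_trans F H K L : agree F H K -> agree F K L -> agree F H L.
Proof. by move=> FHK FKL g gF; rewrite FHK // FKL. Qed.

Lemma near_carrier H g : \forall K \near H, (carrier H g <-> carrier K g).
Proof.
have cts : {for H, continuous ((fun f : {ptws G -> bool} => f g) \o set_val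
    : subgroup G -> bool)}.
  by apply: continuous_comp; [exact: initial_continuous|exact: proj_continuous].
have nH : nbhs H [set K | (set_val K : G -> bool) g = (set_val H : G -> bool) g].
  exact: cts [set (set_val H : G -> bool) g] (discrete_set1 _).
by apply: filterS nH => K; rewrite /carrier /mkset /= => ->.
Qed.

Lemma nbhs_agree F H : \forall K \near H, agree F H K.
Proof.
apply: filter_seq => g _; exact: near_carrier.
Qed.

Lemma nbhs_subgroupP H (U : set (subgroup G)) :
  nbhs H U <-> exists F, agree F H `<=` U.
Proof.
split; last by move=> [F FU]; apply: filterS FU (nbhs_agree F H).
rewrite nbhsE => -[_ [[W oW <-] WH] WU].
pose B F := [set f : {ptws G -> bool} | forall g, g \in F -> f g = set_val H g].
have FF : Filter (filter_from setT B).
  apply: filter_from_filter; first by exists [::].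
  move=> F F' _ _; exists (F ++ F') => // f Bf.
  by split=> g gF; apply: Bf; rewrite mem_cat gF ?orbT.
have : filter_from setT B --> (set_val H : {ptws G -> bool}).
  apply/cvg_sup => g A; rewrite nbhsE => -[_ [[V _ <-] VH] VA].
  exists [:: g] => // f Bf; apply: VA.
  by rewrite /preimage /mkset Bf // mem_head.
move=> /(_ W)[|F _ BW]; first exact: open_nbhs_nbhs.
exists F => K FK; apply/WU/BW => g /FK[HK KH].
by apply/idP/idP.
Qed.

Lemma closure_subgroupP (A : set (subgroup G)) H :
  closure A H <-> forall F, exists2 K, A K & agree F H K.
Proof.
split=> [cAH F|AH U /nbhs_subgroupP[F FU]].
  by have [K [AK FK]] := cAH _ (nbhs_agree F H); exists K.
by have [K AK FK] := AH F; exists K; split=> //; exact: FU.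
Qed.

Lemma closed_subgroupP (A : set (subgroup G)) :
  (forall H, (forall F, exists2 K, A K & agree F H K) -> A H) -> closed A.
Proof. by move=> AP H /closure_subgroupP/AP. Qed.

Lemma conj_sub_agree g F H K :
  agree [seq x ^ g | x <- F] H K -> agree F (conj_sub g H) (conj_sub g K).
Proof. by move=> HK x xF; rewrite !carrier_conj; apply/HK/map_f. Qed.

(** The limit of an ultrafilter of subgroups consists of the elements that
    belong to almost all of them. *)
Lemma compact_subgroup : compact [set: subgroup G].
Proof.
rewrite compact_ultra => U UU _; have UP := @ultra_proper _ _ UU.
pose D (g : G) := [set K : subgroup G | carrier K g].
have DG : subgroups G (fun g => `[< U (D g) >]).
  split=> [|x y /asboolP Dx /asboolP Dy]; apply/asboolP.
    by apply: filterS filterT => K _; exact: carrier1.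
  by apply: filterS2 Dx Dy => K Kx Ky; apply: carrierM => //; exact: carrierV.
exists (SigSub (mem_set DG) : subgroup G); split=> // A.
case/nbhs_subgroupP => F; set H := (X in agree F X) => FA.
have HP g : carrier H g <-> U (D g) by split=> /asboolP.
apply: filterS FA _; apply: filter_seq => g _.
have [UD|UD] := in_ultra_setVsetC (D g) UU.
  by apply: filterS (UD) => K Kg; split=> // _; apply/HP.
apply: filterS (UD) => K nKg; split=> [/HP UDg|//].
by have [? []] := filter_ex (filterI UDg UD).
Qed.

(** Compactness of [K]: for a fixed [q], containing [q] and avoiding [q] are
    both open conditions on a subgroup. The two values of [b] select between
    them. *)
Lemma finite_confinement (Q : set G) (K : set (subgroup G)) (b : bool) :
  closed K -> (forall H, K H -> exists2 q, Q q & (carrier H q <-> b)) ->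
  exists2 F : seq G, (forall q, q \in F -> Q q) &
    forall H, K H -> exists2 q, q \in F & (carrier H q <-> b).
Proof.
move=> cK KQ; apply: contrapT => noF.
pose B (F : seq G) :=
  [set H | K H /\ forall q, q \in F -> Q q -> ~ (carrier H q <-> b)].
have BF : ProperFilter (filter_from setT B).
  apply: filter_from_proper => [|F _].
    apply: filter_from_filter; first by exists [::].
    move=> F F' _ _; exists (F ++ F') => // H [KH FH].
    by split; split=> // q qF; apply: FH; rewrite mem_cat qF ?orbT.
  apply: contrapT => BF0; apply: noF; exists [seq q <- F | `[< Q q >]].
    by move=> q; rewrite mem_filter => /andP[/asboolP].
  move=> H KH; apply: contrapT => Hq; apply: BF0; exists H; split=> // q qF Qq qb.
  by apply: Hq; exists q => //; rewrite mem_filter qF asboolT.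
have [|H [_ clH]] := compact_subgroup BF; first by exists [::].
have KH : K H.
  apply: cK => U HU; apply: clH HU; by exists [::] => // L [].
have [q Qq Hq] := KQ _ KH.
have [|L [[_ /(_ q)]]] := clH (B [:: q]) _ _ (near_carrier H q).
  by exists [:: q].
by rewrite mem_head => /(_ isT Qq) nLq Lq; apply: nLq; rewrite -Lq.
Qed.

End SpaceOfSubgroups.
(** * Uniformly recurrent subgroups *)

Section URS.
Context {G : groupType}.
Implicit Types (H : subgroup G) (K L : set (subgroup G)).

Lemma trivial_urs_is_urs : is_urs (trivial_urs : set (subgroup G)).
Proof.
have conj_trivial g : conj_sub g trivial_sub = trivial_sub :> subgroup G.
  apply: carrier_inj => x; rewrite carrier_conj !carrier_trivial.
  by split=> [/eqP|->]; rewrite ?conj1g // conjg_eq1 => /eqP.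
split=> [||g H ->|L [H LH] _ _ Lt]; first by exists trivial_sub.
- apply: closed_subgroupP => H Hlim; apply: carrier_inj => g.
  by have [_ -> Hg] := Hlim [:: g]; exact: Hg (mem_head _ _).
- exact: conj_trivial.
by apply/seteqP; split=> // _ ->; rewrite -(Lt _ LH).
Qed.

Lemma urs_eq K L H : is_urs K -> is_urs L -> K H -> L H -> K = L.
Proof.
move=> [_ cK iK mK] [_ cL iL mL] KH LH.
have KL0 : K `&` L !=set0 by exists H.
have cKL : closed (K `&` L) by exact: closedI.
have iKL : conj_invariant (K `&` L) by move=> g A [/iK ? /iL ?]; split.
by rewrite -(mK _ KL0 cKL iKL) // (mL _ KL0 cKL iKL).
Qed.

(** The subgroups in [K] that lie below some member of [L] form a closed
    invariant subset of [K]: by confinement, a subgroup below no member of [L]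
    has a finite subset contained in no member of [L]. *)
Lemma urs_le_below K L : is_urs K -> is_urs L -> urs_le K L ->
  forall A, K A -> exists2 B, L B & carrier A `<=` carrier B.
Proof.
move=> [_ cK iK mK] [_ cL iL _] [A0 [B0 [KA0 LB0 AB0]]] A.
pose D := [set A | K A /\ exists2 B, L B & carrier A `<=` carrier B].
suff <- : D = K by case.
apply: mK => [|||A' []//]; first by exists A0; split=> //; exists B0.
- apply: closed_subgroupP => A' A'lim; split.
    by apply: cK; apply/closure_subgroupP => F; have [B []] := A'lim F; exists B.
  apply: contrapT => noB.
  have [B LB|F FA' FL] := @finite_confinement G (carrier A') L false cL.
    apply: contrapT => noq; apply: noB; exists B => // q A'q.
    by apply: contrapT => nBq; apply: noq; exists q.
  have [C [KC [B LB CB]] A'C] := A'lim F; have [q qF [Bq _]] := FL _ LB.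
  by apply: notF; apply/Bq/CB/A'C => //; exact: FA'.
- move=> g A' [KA' [B LB AB]]; split; first exact: iK.
  by exists (conj_sub g B); [exact: iL|move=> x; apply: AB].
Qed.

(** Zorn applies because a chain without upper bound in [K] would, by
    confinement, have a finite subset of its union contained in no member of
    [K], whereas the chain has a member that contains it. *)
Lemma urs_maximal K : is_urs K -> exists2 A, K A &
  forall B, K B -> carrier A `<=` carrier B -> B = A.
Proof.
move=> [[H0 KH0] cK _ _].
pose le (A B : {H | K H}) := `[< carrier (sval A) `<=` carrier (sval B) >].
have [A||A B /asboolP AB /asboolP BA|C totC|[A KA] Amax] := @Zorn {H | K H} le.
- exact/asboolP.
- by move=> B A C /asboolP AB /asboolP BC; apply/asboolP; exact: subset_trans BC.
- case: A B AB BA => [A KA] [B KB] /= AB BA.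
  have eAB : A = B by apply: carrier_inj => g; split=> [/AB|/BA].
  by subst B; congr exist; exact: Prop_irrelevance.
- apply: contrapT => noub.
  pose Q g := exists2 A, C A & carrier (sval A) g.
  have [B KB|F FQ FK] := @finite_confinement G Q K false cK.
    apply: contrapT => noq; apply: noub; exists (exist _ B KB) => A CA.
    apply/asboolP => g Ag; apply: contrapT => nBg; apply: noq.
    by exists g; [exists A|split].
  suff [[A KA] AF] : exists A : {H | K H}, forall q, q \in F -> carrier (sval A) q.
    by have [q qF [Aq _]] := FK _ KA; apply: notF; apply: Aq; exact: AF.
  suff [|[A [_ AF]]] : F = [::] \/ exists A, C A /\
      forall q, q \in F -> carrier (sval A) q.
  + by move=> ->; exists (exist _ H0 KH0).
  + by exists A.
  elim: F FQ {FK} => [|q F IHF] FQ; [by left|right].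
  have [B CB Bq] := FQ q (mem_head _ _).
  have [|->|[A [CA AF]]] := IHF.
  + by move=> r rF; apply: FQ; rewrite in_cons rF orbT.
  + by exists B; split=> // r; rewrite inE => /eqP->.
  have [/asboolP AB|/asboolP BA] := totC _ _ CA CB.
  + exists B; split=> // r; rewrite in_cons => /orP[/eqP->//|/AF]; exact: AB.
  by exists A; split=> // r; rewrite in_cons => /orP[/eqP->|/AF//]; exact: BA.
exists A => // B KB AB.
by have [] := Amax (exist _ B KB) (asboolT AB).
Qed.

(** A maximal member of [K] lies below a member of [L], which lies below a member
    of [K]; maximality makes the three equal, so the two URSs meet. *)
Lemma urs_le_antisym K L : is_urs K -> is_urs L ->
  urs_le K L -> urs_le L K -> K = L.
Proof.
move=> uK uL KL LK; have [A KA Amax] := urs_maximal uK.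
have [B LB AB] := urs_le_below uK uL KL KA.
have [C KC BC] := urs_le_below uL uK LK LB.
have eCA : C = A by apply: Amax => //; exact: subset_trans BC.
apply: (urs_eq (H := A)) => //.
suff -> : A = B by [].
by apply: carrier_inj => g; split=> [/AB|/BC]; rewrite ?eCA.
Qed.

Context (R : realType).

Lemma furstenberg_urs_eq K : is_furstenberg_urs R K -> furstenberg_urs R G = K.
Proof.
move=> fK; have := xgetPex set0 (ex_intro _ K fK).
rewrite -/(furstenberg_urs R G); set L := furstenberg_urs R G => -[aL maxL].
have [aK maxK] := fK.
by apply: urs_le_antisym; [case: aL|case: aK|exact: maxK|exact: maxL].
Qed.

Lemma amenable_trivial : amenable R (trivial_sub : subgroup G).
Proof.
(* the point mass at the identity *)
apply/amenableP; exists (fun A : set G => if `[< A 1%g >] then 1%R else 0%R).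
split=> [|_ A /carrier_trivial->]; last first.
  by rewrite /mkset mul1g.
split=> [A||A B AB]; first by case: asboolP.
  by rewrite asboolT.
have [A1|A1] := asboolP (A 1); have [B1|B1] := asboolP (B 1).
- by have : (A `&` B) 1 by []; rewrite AB.
- by rewrite asboolT ?addr0 //; left.
- by rewrite asboolT ?add0r //; right.
by rewrite asboolF ?addr0 // => -[].
Qed.

Lemma amenable_closure (S : set (subgroup G)) :
  (forall H, S H -> amenable R H) -> forall H, closure S H -> amenable R H.
Proof.
move=> amS H /closure_subgroupP SH; apply/amenableP/has_mean_finite => l lH.
have [K /amS/amenableP mK HK] := SH l.
by apply: has_meanS mK => g gl; apply/(HK g gl)/lH.
Qed.

End URS.
(** * Actions and their stabilizer URS *)

Lemma hausdorff_separate (X : topologicalType) (x y : X) :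
  hausdorff_space X -> x <> y ->
  exists A B, [/\ open A, open B, A x, B y & A `&` B = set0].
Proof.
rewrite open_hausdorff => sep /eqP/sep[[A B] /= [xA yB] [oA oB /eqP AB]].
by exists A, B; split=> //; exact: set_mem.
Qed.

Section Actions.
Context {G : groupType} {X : topologicalType} (a : homeo_action G X).

Lemma actK g : cancel (a g) (a g^-1).
Proof. by move=> x; rewrite -actM mulVg act1. Qed.

Lemma actVK g : cancel (a g^-1) (a g).
Proof. by move=> x; rewrite -actM mulgV act1. Qed.

Lemma act_inj g : injective (a g).
Proof. exact: can_inj (actK g). Qed.

Lemma open_act g U : open U -> open (a g @^-1` U).
Proof. by have /continuousP := @act_continuous _ _ a g; apply. Qed.

Lemma actJ g h x : a (h ^ g) x = x <-> a h (a g x) = a g x.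
Proof.
rewrite conjgE !actM; split=> [hx|->]; last exact: actK.
by rewrite -{2}hx actVK.
Qed.

Lemma carrier_stab x g : carrier (stab a x) g <-> a g x = x.
Proof. by split=> [/eqP|gx]; [|apply/eqP]. Qed.

Lemma stab_act g x : stab a (a g x) = conj_sub g (stab a x).
Proof.
apply: carrier_inj => h; rewrite carrier_conj !carrier_stab.
exact: iff_sym (actJ _ _ _).
Qed.

Lemma stab_agree_act g F x H :
  agree [seq f ^ g | f <- F] (stab a x) H -> agree F (stab a (a g x)) (conj_sub g H).
Proof. by rewrite stab_act; exact: conj_sub_agree. Qed.

Section Hausdorff.
Hypothesis hausX : hausdorff_space X.

Lemma open_moved g : open [set x | a g x <> x].
Proof.
rewrite openE => x /= /(hausdorff_separate hausX)[A [B [oA oB Agx Bx AB]]].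
have nx : nbhs x (a g @^-1` A `&` B).
  by apply: open_nbhs_nbhs; split; [exact: openI (open_act _ oA) oB|split].
apply: filterS nx => y [Ay By] gy.
have : (A `&` B) y by split=> //; rewrite -gy.
by rewrite AB.
Qed.

(** Elements that move [x] also move the nearby points, the space being
    Hausdorff; only those that fix [x] restrict continuity. *)
Lemma continuous_stabP x : {for x, continuous (stab a)} <->
  forall g, a g x = x -> \forall y \near x, a g y = y.
Proof.
split=> [ctx g gx|fixx U].
  have nx : nbhs x [set y | agree [:: g] (stab a x) (stab a y)].
    exact: ctx _ (nbhs_agree [:: g] (stab a x)).
  apply: filterS nx => y /(_ g (mem_head _ _)).
  by rewrite !carrier_stab => -[+ _]; exact.
move=> /nbhs_subgroupP[F FU].
suff nx : nbhs x [set y | agree F (stab a x) (stab a y)].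
  by apply: filterS nx => y; exact: FU.
apply: filter_seq => g _.
suff nx : nbhs x [set y | a g x = x <-> a g y = y].
  by apply: filterS nx => y; rewrite /mkset !carrier_stab.
have [gx|gx] := pselect (a g x = x).
  by apply: filterS (fixx _ gx).
have nx : nbhs x [set y | a g y <> y].
  by apply: open_nbhs_nbhs; split=> //; exact: open_moved.
by apply: filterS nx.
Qed.

Lemma continuous_stab_act g x :
  {for x, continuous (stab a)} -> {for a g x, continuous (stab a)}.
Proof.
move=> /continuous_stabP fixx; apply/continuous_stabP => h /actJ/fixx nx.
have nx' : nbhs (a g^-1 (a g x)) [set y | a (h ^ g) y = y] by rewrite actK.
have ngx : nbhs (a g x) (a g^-1 @^-1` [set y | a (h ^ g) y = y]).
  exact: (@act_continuous _ _ a g^-1 (a g x) _ nx').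
by apply: filterS ngx => y /= /actJ; rewrite actVK.
Qed.

Hypothesis compactX : compact [set: X].

Lemma open_shrink (W : set X) : open W -> W !=set0 ->
  exists V : set X, [/\ open V, V !=set0 & closure V `<=` W].
Proof.
move=> oW [x Wx].
have nx := open_nbhs_nbhs (conj oW Wx).
have [|V nV VW] := compact_regular (x := x) hausX compactX _ nx.
  exact: filterT.
exists V°; split; first exact: open_interior.
  by exists x.
exact: subset_trans (closureS (@interior_subset _ V)) VW.
Qed.

(** The Baire argument: for each [g], a nonempty open set contains a nonempty
    open set on which [g] is the identity or moves all points. Running through
    the countably many [g] with nested closures leads to a continuity point. *)
Lemma continuous_stab_exists : countable [set: G] -> [set: X] !=set0 ->
  exists x, {for x, continuous (stab a)}.
Proof.
move=> /countable_injP[e einj] X0.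
pose tame g (V : set X) := V `<=` [set x | a g x = x] \/ V `<=` [set x | a g x <> x].
pose openset := {V : set X | open V /\ V !=set0}.
have /choice[next nextP] : forall nV : nat * openset, exists V' : openset,
    closure (sval V') `<=` sval nV.2 /\
    forall g, e g = nV.1 -> tame g (sval V').
  move=> [n [V [oV V0]]] /=.
  suff [W [oW W0 WV Wt]] : exists W, [/\ open W, W !=set0, W `<=` V &
      forall g, e g = n -> tame g W].
    have [V' [oV' V'0 V'W]] := open_shrink oW W0.
    exists (exist _ V' (conj oV' V'0)) => /=.
    split; first exact: subset_trans V'W WV.
    have V'W' := subset_trans (@subset_closure _ V') V'W.
    by move=> g /Wt[Wg|Wg]; [left|right]; exact: subset_trans V'W' Wg.
  have [[g egn]|noe] := pselect (exists g, e g = n); last first.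
    by exists V; split=> // g egn; case: noe; exists g.
  have eg g' : e g' = n -> g' = g.
    by rewrite -egn => /einj; apply; rewrite inE.
  have [Vg|/existsNP[x /not_implyP[Vx gx]]] := pselect (V `<=` [set x | a g x = x]).
    by exists V; split=> // g' /eg->; left.
  exists (V `&` [set x | a g x <> x]); split; last by move=> g' /eg->; right.
  - exact: openI oV (open_moved g).
  - by exists x.
  - by [].
pose V := fix V n : openset :=
  if n is n'.+1 then next (n', V n') else exist _ setT (conj openT X0).
have VS n : closure (sval (V n.+1)) `<=` sval (V n) by have [] := nextP (n, V n).
have Vdecr n m : (n <= m)%N -> sval (V m) `<=` sval (V n).
  elim: m => [|m IHm]; first by rewrite leqn0 => /eqP->.
  rewrite leq_eqVlt => /orP[/eqP->//|/IHm]; apply: subset_trans.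
  exact: subset_trans (@subset_closure _ _) (VS m).
have FF : ProperFilter (filter_from setT (sval \o V)).
  apply: filter_from_proper; last by move=> n _; have [_] := svalP (V n).
  apply: filter_from_filter; first by exists 0.
  move=> n m _ _; exists (maxn n m) => // x Vx.
  by split; apply: Vdecr Vx; rewrite ?leq_maxl ?leq_maxr.
have [|x [_ clx]] := compactX FF; first by exists 0.
have Vx n : sval (V n) x by apply: VS => U Ux; apply: clx Ux; exists n.+1.
exists x; apply/continuous_stabP => g gx.
have [_ /(_ g erefl)[Vg|/(_ _ (Vx (e g).+1))//]] := nextP (e g, V (e g)).
apply: filterS Vg _; apply: open_nbhs_nbhs; split; last exact: (Vx (e g).+1).
by have [] := svalP (V (e g).+1).
Qed.

Hypothesis minX : minimal_action a.

Lemma minimal_orbit (U : set X) x : open U -> U !=set0 -> exists g, U (a g x).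
Proof.
by move=> oU U0; have [y [Uy [g _ gy]]] := @minX x U U0 oU; exists g; rewrite gy.
Qed.

Lemma minimal_finite (U : set X) : open U -> U !=set0 ->
  exists F : seq G, forall x, exists2 g, g \in F & U (a g x).
Proof.
move=> oU U0; apply: contrapT => noF.
pose B (F : seq G) := [set x | forall g, g \in F -> ~ U (a g x)].
have BF : ProperFilter (filter_from setT B).
  apply: filter_from_proper => [|F _].
    apply: filter_from_filter; first by exists [::].
    move=> F F' _ _; exists (F ++ F') => // x Fx.
    by split=> g gF; apply: Fx; rewrite mem_cat gF ?orbT.
  apply: contrapT => BF0; apply: noF; exists F => x.
  apply: contrapT => nox; apply: BF0; exists x => g gF Ugx.
  by apply: nox; exists g.
have [|x [_ clx]] := compactX BF; first by exists [::].
have [g Ugx] := minimal_orbit x oU U0.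
have [||y [/(_ g (mem_head _ _))//]] := clx (B [:: g]) (a g @^-1` U).
  by exists [:: g].
by apply: open_nbhs_nbhs; split=> //; exact: open_act.
Qed.

(** Minimality of the stabilizer URS: let [y] be a continuity point and [U] a
    neighborhood on which stabilizers agree with that of [y] on a finite set.
    Finitely many translates of [U] cover the space, so any [H] in the closure,
    approximated on the corresponding conjugates of the finite set by one
    stabilizer, has a conjugate that agrees with the stabilizer of [y]. *)
Lemma stabilizer_urs_is_urs : countable [set: G] -> [set: X] !=set0 ->
  is_urs (stabilizer_urs a).
Proof.
move=> countG X0; split.
- have [x cx] := continuous_stab_exists countG X0.
  by exists (stab a x); apply: subset_closure; exists x.
- exact: closed_closure.
- move=> g H /closure_subgroupP SH; apply/closure_subgroupP => F.
  have [_ [x cx <-] FH] := SH [seq f ^ g | f <- F].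
  exists (stab a (a g x)); first by exists (a g x) => //; exact: continuous_stab_act.
  by rewrite stab_act; exact: conj_sub_agree.
move=> L [H LH] cL iL LS; apply/seteqP; split=> //.
move=> K SK; apply: (cL); apply: closureS SK => _ [y cy <-].
apply: cL; apply/closure_subgroupP => F.
have ny : nbhs y [set z | agree F (stab a y) (stab a z)].
  exact: cy _ (nbhs_agree F (stab a y)).
move: ny; rewrite nbhsE => -[U [oU Uy] UF].
have [E EP] := minimal_finite oU (ex_intro _ y Uy).
have /closure_subgroupP/(_ [seq f ^ g | f <- F, g <- E]) := LS _ LH.
move=> [_ [z _ <-] Hz]; have [g gE Ugz] := EP z.
exists (conj_sub g H); first exact: iL.
apply: agree_trans (UF _ Ugz) _; apply: stab_agree_act => f fF.
apply: iff_sym; apply: Hz; case/mapP: fF => f' f'F ->.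
by apply/allpairsP; exists (f', g).
Qed.

End Hausdorff.
End Actions.
(** * Extreme boundary actions *)

Section Boundary.
Context {G : groupType} {X : topologicalType} (a : homeo_action G X).
Hypothesis hausX : hausdorff_space X.
Hypothesis boundary_a : extreme_boundary_action a.

Definition three_points := exists x y z : X, [/\ x <> y, y <> z & x <> z].

(** Minimality moves the point at which a closed set concentrates into any
    given open set. *)
Lemma boundary_compress (C U : set X) : closed C -> C <> setT ->
  open U -> U !=set0 -> exists g, forall y, C y -> U (a g y).
Proof.
move=> cC CT oU U0; have [_ minX proxX] := boundary_a.
have [x xP] := proxX C cC CT; have [h Uhx] := minimal_orbit minX x oU U0.
have [g gC] := xP _ (open_act a h oU) Uhx.
by exists (h * g) => y Cy; rewrite actM; apply: gC; exists y.
Qed.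

(** An isolated point [z] would swallow, by a single homeomorphism, all the
    other points, of which there are at least two. *)
Lemma boundary_not_isolated (U : set X) (z : X) : three_points ->
  open U -> U z -> exists2 y, U y & y <> z.
Proof.
move=> three oU Uz; apply: contrapT => noy.
have Uonly y : U y -> y = z.
  by move=> Uy; apply: contrapT => yz; apply: noy; exists y.
have UT : ~` U <> setT by move=> UT; have : (~` U) z by rewrite UT.
have [g gU] := boundary_compress (open_closedC oU) UT oU (ex_intro _ z Uz).
have one u v : u <> z -> v <> z -> u = v.
  move=> uz vz; apply: (@act_inj _ _ a g).
  have gz w : w <> z -> a g w = z by move=> wz; apply/Uonly/gU => /Uonly.
  exact: etrans (gz u uz) (esym (gz v vz)).
have [x [y [w [xy yw xw]]]] := three.
have [xz|xz] := pselect (x = z); first by apply: yw; apply: one => e; subst.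
have [yz|yz] := pselect (y = z); last exact: xy (one _ _ xz yz).
by apply: xw; apply: one => // e; subst.
Qed.

Lemma boundary_avoid (s : seq X) (U : set X) : three_points ->
  open U -> U !=set0 -> exists2 y, U y & y \notin s.
Proof.
move=> three; elim: s U => [|z s IHs] U oU [u Uu]; first by exists u.
pose W := U `&` [set y | y <> z].
have oW : open W.
  apply: openI => //; rewrite openE => y /= /(hausdorff_separate hausX).
  move=> [A [B [oA oB Ay Bz AB]]].
  apply: filterS (open_nbhs_nbhs (conj oA Ay)) => w Aw wz; subst w.
  by have : (A `&` B) z by []; rewrite AB.
have W0 : W !=set0.
  have [uz|uz] := pselect (u = z); last by exists u.
  subst u; have [y Uy yz] := boundary_not_isolated three oU Uu.
  by exists y.
have [y [Uy yz] ys] := IHs W oW W0.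
by exists y => //; rewrite in_cons negb_or ys andbT; apply/eqP.
Qed.

Context {R : realType}.

Local Open Scope ring_scope.

(** Three points have disjoint neighborhoods, whose means add up to at most 1. *)
Lemma small_open (mu : set X -> R) : three_points -> mean mu ->
  exists V, [/\ open V, V !=set0 & mu V < 2^-1].
Proof.
move=> [x [y [z [xy yz xz]]]] mmu; have [_ mu1 muU] := mmu.
have [A [B [oA oB Ax By AB]]] := hausdorff_separate hausX xy.
have [A' [B' [oA' oB' Ay Bz AB']]] := hausdorff_separate hausX yz.
have [A'' [B'' [oA'' oB'' Ax' Bz' AB'']]] := hausdorff_separate hausX xz.
apply: contrapT => noV.
have big V v : open V -> V v -> 2^-1 <= mu V.
  move=> oV Vv; rewrite leNgt; apply/negP => muV.
  by apply: noV; exists V; split=> //; exists v.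
have b1 : 2^-1 <= mu (A `&` A'') by apply: (big _ x) => //; exact: openI.
have b2 : 2^-1 <= mu (B `&` A') by apply: (big _ y) => //; exact: openI.
have b3 : 2^-1 <= mu (B' `&` B'') by apply: (big _ z) => //; exact: openI.
have d12 : (A `&` A'') `&` (B `&` A') = set0.
  by apply/seteqP; split=> // w [[? _] [? _]]; rewrite -AB.
have d123 : ((A `&` A'') `|` (B `&` A')) `&` (B' `&` B'') = set0.
  apply/seteqP; split=> // w [[[_ ?]|[_ ?]] [? ?]]; first by rewrite -AB''.
  by rewrite -AB'.
have := mean_le1 (((A `&` A'') `|` (B `&` A')) `|` (B' `&` B'')) mmu.
by rewrite !muU //; lra.
Qed.

(** Suppose no member of [L] is contained in the stabilizer of [x]. By
    confinement, finitely many elements [q] that move [x] meet all members of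
    [L], and [x] has a neighborhood [U] disjoint from all [q U]. A mean on the
    space invariant under some [H] in [L] gives an open set [V] of mean less
    than one half; compress its complement [C] into [U] by some [g]. One of
    the [q] belongs to the conjugate of [H] by [g], so [H] contains an element
    that carries [C] off itself, although [C] has mean more than one half. *)
Lemma amenable_urs_below_stab (L : set (subgroup G)) (x : X) :
  three_points -> amenable_urs R L ->
  exists2 K, L K & carrier K `<=` carrier (stab a x).
Proof.
move=> three [[[H LH] cL iL _] amL]; apply: contrapT => noK.
have [K LK|F Fx FL] := @finite_confinement G [set q | a q x <> x] L true cL.
  apply: contrapT => noq; apply: noK; exists K => // q Kq.
  apply/carrier_stab; apply: contrapT => qx; apply: noq.
  by exists q => //; split.
have /choice[W WP] : forall q, exists W : set X, q \in F ->
    nbhs x W /\ forall y, W y -> ~ W (a q y).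
  move=> q; have [/Fx qx|] := boolP (q \in F); last by exists setT.
  have [A [B [oA oB Aqx Bx AB]]] := hausdorff_separate hausX qx.
  exists (B `&` a q @^-1` A) => _; split.
    by apply: open_nbhs_nbhs; split=> //; exact: openI oB (open_act a q oA).
  move=> y [_ Aqy] [Bqy _].
  by have : (A `&` B) (a q y) by []; rewrite AB.
have : nbhs x [set y | forall q, q \in F -> W q y].
  by apply: filter_seq => q /WP[].
rewrite nbhsE => -[U [oU Ux] UW].
have UF q y : q \in F -> U y -> ~ U (a q y).
  by move=> qF Uy Uqy; have [_ /(_ y)] := WP q qF; apply; apply: UW.
have [m [mm mH]] : has_mean (R := R) (carrier H) by apply/amenableP; exact: amL.
pose mu (A : set X) := m [set g | A (a g x)].
have mmu : mean mu := mean_preimage (fun g => a g x) mm.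
have muH h A : carrier H h -> mu [set y | A (a h y)] = mu A.
  move=> Hh; rewrite /mu -[RHS](mH h) //.
  by congr m; apply/funext => g; rewrite /mkset actM.
have [V [oV V0 muV]] := small_open three mmu.
have [_ mu1 muU] := mmu.
have muC : mu V + mu (~` V) = 1 by rewrite -muU ?setICr // setUv.
have CT : ~` V <> setT.
  by move=> CT; have [v Vv] := V0; have : (~` V) v by rewrite CT.
have [g gU] := boundary_compress (open_closedC oV) CT oU (ex_intro _ x Ux).
have [q qF [_ Hq]] := FL _ (iL g _ LH).
have {}Hq : carrier H (q ^ g)%g by apply/carrier_conj/Hq.
pose D : set X := [set y | (~` V) (a (q ^ g)%g y)].
have CD : (~` V) `&` D = set0.
  apply/seteqP; split=> // y [Cy Dy]; apply: (UF _ _ qF (gU _ Cy)).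
  by have := gU _ Dy; rewrite conjgE !actM actVK.
have := mean_le1 ((~` V) `|` D) mmu; rewrite muU // muH //; lra.
Qed.

End Boundary.
(** * Rigid stabilizers *)

Section Rist.
Context {G : groupType} {X : topologicalType} (a : homeo_action G X).
Hypothesis faithful_a : faithful_action a.

Definition rist (V : set X) : set G := [set g | forall y, ~ V y -> a g y = y].

Lemma rist_stable V g y : rist V g -> V y -> V (a g y).
Proof.
move=> gV Vy; apply: contrapT => nV; apply: (nV).
by rewrite (act_inj (gV _ nV)).
Qed.

Lemma ristM V g h : rist V g -> rist V h -> rist V (g * h).
Proof. by move=> gV hV y nVy; rewrite actM hV // gV. Qed.

Lemma ristV V g : rist V g -> rist V g^-1.
Proof. by move=> gV y nVy; apply: (@act_inj _ _ a g); rewrite actVK gV. Qed.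

Lemma rist_eq V g h : rist V g -> rist V h ->
  (forall y, V y -> a g y = a h y) -> g = h.
Proof.
move=> gV hV gh; have /faithful_a : forall y, a (h^-1 * g) y = y.
  move=> y; have [Vy|nVy] := pselect (V y); first by rewrite actM gh // actK.
  by rewrite actM gV // (ristV hV).
by move=> hg; rewrite -[g](mulVKg h) hg mulg1.
Qed.

(** The elements of [H] that act on [V] as elements of [rist V] form a subgroup
    of [H], of which [rist V] is a quotient: restrict to [V] and extend by the
    identity. *)
Lemma has_mean_rist (R : realType) (H : subgroup G) (V : set X) :
  (forall t, rist V t -> exists2 h, carrier H h & forall y, V y -> a h y = a t y) ->
  has_mean (R := R) (carrier H) -> has_mean (R := R) (rist V).
Proof.
move=> HV; pose ext h t := rist V t /\ forall y, V y -> a h y = a t y.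
have extM g h s t : ext g s -> ext h t -> ext (g * h) (s * t).
  move=> [sV gs] [tV ht]; split=> [|y Vy]; first exact: ristM.
  by rewrite !actM ht // gs //; exact: rist_stable.
have extV h t : ext h t -> ext h^-1 t^-1.
  move=> [tV ht]; split=> [|y Vy]; first exact: ristV.
  apply: (@act_inj _ _ a h); rewrite actVK ht ?actVK //.
  by apply: rist_stable => //; exact: ristV.
have H'G : subgroups G (fun h => `[< carrier H h /\ exists t, ext h t >]).
  split=> [|g h /asboolP[Hg [s gs]] /asboolP[Hh [t ht]]]; apply/asboolP.
    by split; [exact: carrier1|exists 1; split=> // y _; rewrite act1].
  split; first by apply: carrierM => //; exact: carrierV.
  by exists (s * t^-1); apply: extM => //; exact: extV.
pose H' : subgroup G := SigSub (mem_set H'G).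
have H'P h : carrier H' h <-> carrier H h /\ exists t, ext h t.
  by split=> /asboolP.
have [f [fH' fM]] := retraction H'.
pose phi h := xget 1 [set t | ext h t].
have phiP h : carrier H' h -> ext h (phi h).
  by move=> /H'P[_ ht]; exact: (xgetPex 1 ht).
apply: (@has_mean_push _ _ _ _ (phi \o f)) => t tV.
have [h Hh ht] := HV t tV; exists h => // x.
have H'h : carrier H' h by apply/H'P; split=> //; exists t.
rewrite /= fM //.
have [pV pE] := phiP _ (carrierM H'h (fH' x)).
have [qV qE] := extM _ _ _ _ (conj tV ht) (phiP _ (fH' x)).
by apply: (rist_eq pV qV) => y Vy; rewrite -pE // -qE.
Qed.

(** Take the product of all [rho p]: on [V p], the other factors are the
    identity. *)
Lemma rist_prod (F : seq G) (V : G -> set X) (rho : G -> G) : uniq F ->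
  (forall p q, p \in F -> q \in F -> p <> q -> V p `&` V q = set0) ->
  (forall p, p \in F -> rist (V p) (rho p)) ->
  exists2 g, rist [set y | exists2 p, p \in F & V p y] g &
    forall p y, p \in F -> V p y -> a g y = a (rho p) y.
Proof.
elim: F => [|p F IHF] /=; first by exists 1 => // y _; rewrite act1.
move=> /andP[pF uF] disj rhoV.
have [q r qF rF|q qF|g gF grho] := IHF uF.
- by apply: disj; rewrite in_cons ?qF ?rF orbT.
- by apply: rhoV; rewrite in_cons qF orbT.
have rhop := rhoV p (mem_head _ _).
have disjp q y : q \in F -> V q y -> ~ V p y.
  move=> qF Vqy Vpy; have : (V p `&` V q) y by [].
  rewrite disj ?mem_head ?in_cons ?qF ?orbT // => pq.
  by move: pF; rewrite pq qF.
exists (rho p * g) => [y nV|q y].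
  rewrite actM gF ?rhop // => [Vpy|[q qF Vqy]]; apply: nV.
    by exists p; rewrite ?mem_head.
  by exists q; rewrite // in_cons qF orbT.
rewrite in_cons actM => /orP[/eqP-> Vpy|qF Vqy].
  by rewrite gF // => -[r rF Vry]; exact: (disjp r y).
rewrite (grho q) // rhop //; apply: (disjp q) => //.
by apply: rist_stable => //; apply: rhoV; rewrite in_cons qF orbT.
Qed.

End Rist.
(** * Amenable uniformly recurrent subgroups and rigid stabilizers *)

Section RistMeans.
Context {G : groupType} {X : topologicalType} (a : homeo_action G X).
Hypothesis hausX : hausdorff_space X.
Hypothesis faithful_a : faithful_action a.
Hypothesis boundary_a : extreme_boundary_action a.
Hypothesis threeX : three_points (X := X).

(** Choose the points one after the other: each new one has to avoid finitely
    many points, which is possible since no point is isolated. *)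
Lemma separated_points (F : seq G) : (forall p, p \in F -> p <> 1) ->
  exists x : G -> X, forall p q, p \in F -> q \in F ->
    a p^-1 (x p) <> x q /\ (p <> q -> x p <> x q).
Proof.
have [x0 _] := threeX; elim: F => [|p F IHF] F1; first by exists (fun _ => x0).
have [|x xP] := IHF; first by move=> q qF; apply: F1; rewrite in_cons qF orbT.
have [pF|pF] := boolP (p \in F).
  have sub q : q \in p :: F -> q \in F by rewrite in_cons => /orP[/eqP->|].
  by exists x => r q /sub rF /sub; exact: xP.
have moved0 : [set y | a p^-1 y <> y] !=set0.
  apply: contrapT => nomove; apply: (F1 p (mem_head _ _)); apply: invg_inj.
  rewrite invg1; apply: faithful_a => y; apply: contrapT => py.
  by apply: nomove; exists y.
(* these points clash with a choice made earlier, as [z] or as [p^-1 z] *)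
pose s := [seq x q | q <- F] ++ [seq a q^-1 (x q) | q <- F]
  ++ [seq a p (x q) | q <- F].
have [z pz zs] :=
  boundary_avoid hausX boundary_a s threeX (open_moved a hausX p^-1) moved0.
have notin (f : G -> X) q : q \in F -> {subset [seq f q | q <- F] <= s} -> z <> f q.
  by move=> qF fs zf; move: zs; rewrite zf => /negP; apply; apply/fs/map_f.
exists (fun q => if q == p then z else x q) => r q.
rewrite !in_cons.
have [->|rp] := eqVneq r p; have [->|qp] := eqVneq q p => //= rF qF.
- split; last first.
    by move=> _; apply: (notin x) => // w wF; rewrite mem_cat wF.
  move=> pzq; apply: (notin (fun q => a p (x q)) q qF).
    by move=> w wF; rewrite !mem_cat wF !orbT.
  by rewrite -pzq actVK.
- split.
    apply/nesym/(notin (fun q => a q^-1 (x q))) => // w wF.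
    by rewrite !mem_cat wF !orbT.
  by move=> _; apply/nesym/(notin x) => // w wF; rewrite mem_cat wF.
by exact: xP.
Qed.

Lemma separated_sets (F : seq G) : (forall p, p \in F -> p <> 1) ->
  exists V : G -> set X, [/\ forall p, p \in F -> open (V p) /\ V p !=set0,
    forall p q y, p \in F -> q \in F -> V p y -> ~ V q (a p^-1 y) &
    forall p q, p \in F -> q \in F -> p <> q -> V p `&` V q = set0].
Proof.
move=> /separated_points[x xP].
have /choice[AB ABP] : forall pq : G * G, exists AB : set X * set X,
    pq.1 \in F -> pq.2 \in F ->
    [/\ nbhs (x pq.1) AB.1, nbhs (x pq.2) AB.2,
      forall y, AB.1 y -> ~ AB.2 (a pq.1^-1 y) &
      pq.1 <> pq.2 -> AB.1 `&` AB.2 = set0].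
  move=> [p q] /=.
  have [[pF qF]|] := pselect (p \in F /\ q \in F); last first.
    by move=> npq; exists (setT, setT) => pF qF; case: npq.
  have [/(hausdorff_separate hausX)[A [B [oA oB Ax Bx ABd]]] xpq] := xP p q pF qF.
  suff [A' [B' [nA' nB' AB']]] : exists A' B', [/\ nbhs (x p) A', nbhs (x q) B' &
      p <> q -> A' `&` B' = set0].
    exists (a p^-1 @^-1` A `&` A', B `&` B') => _ _ /=; split.
    - apply: filterI => //; apply: open_nbhs_nbhs; split=> //.
      exact: open_act.
    - by apply: filterI => //; exact: open_nbhs_nbhs.
    - by move=> y [Ay _] [By _]; have : (A `&` B) (a p^-1 y) by []; rewrite ABd.
    - by move=> /AB' AB'0; rewrite setIACA AB'0 setI0.
  have [pq|pq] := pselect (p = q).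
    by exists setT, setT; split=> //; exact: filterT.
  have [A' [B' [oA' oB' A'x B'x AB']]] := hausdorff_separate hausX (xpq pq).
  by exists A', B'; split=> //; exact: open_nbhs_nbhs.
pose W p := [set y | forall q, q \in F -> (AB (p, q)).1 y /\ (AB (q, p)).2 y].
have WV p : (W p)° `<=` W p by exact: interior_subset.
exists (fun p => (W p)°); split=> [p pF|p q y pF qF|p q pF qF pq].
- split; first exact: open_interior.
  exists (x p); apply: filter_seq => q qF; apply: filterI.
    by have [] := ABP (p, q) pF qF.
  by have [] := ABP (q, p) qF pF.
- move=> /WV/(_ q qF)[Ay _] /WV/(_ p pF)[_].
  by have [_ _ + _] := ABP (p, q) pF qF; apply.
apply/seteqP; split=> // y [/WV/(_ q qF)[Ay _] /WV/(_ p pF)[_ By]].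
by have [_ _ _ /(_ pq)<-] := ABP (p, q) pF qF.
Qed.

(** By confinement there is a finite set [F] of nontrivial elements that meets
    all members of [L]. Choose small disjoint open sets [V p], for [p] in [F],
    such that [p^-1] maps [V p] off all of them. A combination over [p] of
    elements of the rigid stabilizers conjugates [H] to a member of [L]; hence
    for some [p], each [rho] in [rist (V p)] has an extension [gamma],
    supported on the union of the sets [V q], with [p ^ gamma] in [H]. Dividing
    by the same for [rho = 1] leaves an element of [H] that acts on [V p] as
    [rho^-1], so [rist (V p)] is a subquotient of [H]. *)
Lemma rist_mean_of_nontrivial_urs (R : realType) (L : set (subgroup G)) :
  amenable_urs R L -> ~ L trivial_sub ->
  exists V, [/\ open V, V !=set0 & has_mean (R := R) (rist a V)].
Proof.
move=> [[[H LH] cL iL _] amL] nL.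
have [K LK|F0 F01 FL0] := @finite_confinement G [set q | q <> 1] L true cL.
  apply: contrapT => noq; apply: nL; suff <- : K = trivial_sub by [].
  apply: carrier_inj => g; rewrite carrier_trivial.
  split=> [Kg|->]; last exact: carrier1.
  by apply: contrapT => g1; apply: noq; exists g.
pose F := undup F0; have uF : uniq F := undup_uniq F0.
have F1 p : p \in F -> p <> 1 by rewrite mem_undup; exact: F01.
have FL K : L K -> exists2 q, q \in F & carrier K q.
  by move=> /FL0[q qF Kq]; exists q; [rewrite mem_undup|apply/Kq].
have [V [VF Vmove Vdisj]] := separated_sets F1.
pose W := [set y | exists2 p, p \in F & V p y].
have [p pF Hp] : exists2 p, p \in F & forall rho, rist a (V p) rho ->
    exists gamma, [/\ rist a W gamma, forall y, V p y -> a gamma y = a rho y &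
                      carrier H (p ^ gamma)].
  apply: contrapT => nop.
  have /choice[rho rhoP] : forall p, exists rho, p \in F -> rist a (V p) rho /\
      forall gamma, rist a W gamma -> (forall y, V p y -> a gamma y = a rho y) ->
      ~ carrier H (p ^ gamma).
    move=> p; have [pF|] := boolP (p \in F); last by exists 1.
    apply: contrapT => norho; apply: nop; exists p => // rho rhoV.
    apply: contrapT => nogamma; apply: norho; exists rho => _; split=> // gamma.
    by move=> gW grho Hg; apply: nogamma; exists gamma.
  have rhoV q : q \in F -> rist a (V q) (rho q) by move=> /rhoP[].
  have [gamma gW grho] := rist_prod uF Vdisj rhoV.
  have [q qF /carrier_conj Hq] := FL _ (iL gamma H LH).
  by have [_ /(_ gamma gW)] := rhoP q qF; apply=> // y; exact: grho.
have [oV V0] := VF p pF; exists (V p); split=> //.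
apply: (@has_mean_rist _ _ _ faithful_a R H) => //.
  2: by apply/amenableP; exact: amL.
move=> t tV.
have [gamma [gW grho Hg]] := Hp _ (ristV tV).
have [gamma0 [g0W g0rho Hg0]] : exists gamma, [/\ rist a W gamma,
    forall y, V p y -> a gamma y = y & carrier H (p ^ gamma)].
  have [|g [gW' g1 Hg']] := Hp 1; first by move=> y _; rewrite act1.
  by exists g; split=> // y /g1; rewrite act1.
exists (p ^ gamma * (p ^ gamma0)^-1).
  by apply: carrierM => //; exact: carrierV.
move=> y Vy.
have nW : ~ W (a p^-1 y) by move=> [q qF]; exact: Vmove.
rewrite -conjVg !conjgE !actM g0rho // (ristV g0W) // gW // actVK.
by apply: (@act_inj _ _ a gamma); rewrite actVK grho ?actK //; exact: rist_stable.
Qed.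

(** A finite set of elements fixing a neighborhood of [x] pointwise is
    conjugate into the rigid stabilizer of any nonempty open set: compress the
    complement of the neighborhood into that set. *)
Lemma amenable_stab_of_rist (R : realType) (V : set X) (x : X) :
  open V -> V !=set0 -> has_mean (R := R) (rist a V) ->
  {for x, continuous (stab a)} -> amenable R (stab a x).
Proof.
move=> oV V0 mV /(continuous_stabP a hausX) fixx.
apply/amenableP/has_mean_finite => l lx.
have : nbhs x [set y | forall t, t \in l -> a t y = y].
  by apply: filter_seq => t /lx/carrier_stab; exact: fixx.
rewrite nbhsE => -[U [oU Ux] Ul].
have UT : ~` U <> setT by move=> UT; have : (~` U) x by rewrite UT.
have [g gV] := boundary_compress boundary_a (open_closedC oU) UT oV V0.
apply: (has_mean_conj (g := g^-1)) mV => t tl y nVy.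
apply/actJ; apply: Ul => //; apply: contrapT => /gV.
by rewrite actVK.
Qed.

End RistMeans.

Lemma three_points_or_subsingleton (X : topologicalType) :
  ~ ([set: X] #= `I_2)%card -> three_points (X := X) \/ forall x y : X, x = y.
Proof.
move=> card2; apply: contrapT => /not_orP[no3 /existsNP[x /existsNP[y xy]]].
apply: card2; apply/card_set_bijP.
have Xxy z : z = x \/ z = y.
  have [|zx] := pselect (z = x); first by left.
  have [|zy] := pselect (z = y); first by right.
  by exfalso; apply: no3; exists x, y, z; split=> // e; [case: zy|case: zx].
have yx : (y == x) = false by apply/eqP/nesym.
exists (fun z => if z == x then 0%N else 1%N); split=> [z _|u v _ _|[|[|n]] //= _].
- by case: eqP.
- by have [->|->] := Xxy u; have [->|->] := Xxy v; rewrite ?eqxx ?yx.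
- by exists x; rewrite ?eqxx.
- by exists y; rewrite ?yx.
Qed.

Local Open Scope card_scope.

Theorem theorem3p13 (R : realType) (G : groupType) (X : topologicalType)
    (a : homeo_action G X)
    (countableG : countable [set: G])
    (hausdorffX : hausdorff_space X)
    (cardX : ~ ([set: X] #= `I_2))
    (faithful_a : faithful_action a)
    (boundary_a : extreme_boundary_action a) :
  ((exists x : X, amenable R (stab a x)) ->
     furstenberg_urs R G = stabilizer_urs a) /\
  ((forall x : X, ~ amenable R (stab a x)) ->
     furstenberg_urs R G = trivial_urs).
Proof.
have [compactX minX _] := boundary_a.
have dich := three_points_or_subsingleton cardX.
split=> [[x amx]|namx]; apply: furstenberg_urs_eq.
  have X0 : [set: X] !=set0 by exists x.
  have ursS := stabilizer_urs_is_urs hausdorffX compactX minX countableG X0.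
  split; [split=> //|move=> L aL].
    (* stabilizers at continuity points are limits of conjugates of [stab a x] *)
    apply: amenable_closure => _ [y cy <-].
    apply: (@amenable_closure _ _ (range (fun g => conj_sub g (stab a x)))).
      move=> _ [g _ <-]; apply/amenableP; move/amenableP: amx.
      by apply: (has_mean_conj (g := g)) => t /carrier_conj.
    apply/closure_subgroupP => F.
    have ny : nbhs y [set z | agree F (stab a y) (stab a z)].
      exact: cy _ (nbhs_agree F (stab a y)).
    move: ny; rewrite nbhsE => -[U [oU Uy] UF].
    have [g Ugx] := minimal_orbit minX x oU (ex_intro _ y Uy).
    exists (conj_sub g (stab a x)); first by exists g.
    by rewrite -stab_act; exact: UF.
  have [y cy] := continuous_stab_exists a hausdorffX compactX countableG X0.
  suff [K LK Ky] : exists2 K, L K & carrier K `<=` carrier (stab a y).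
    exists K, (stab a y); split=> //.
    by apply: subset_closure; exists y.
  have [three|X1] := dich.
    exact: (amenable_urs_below_stab hausdorffX boundary_a y three aL).
  have [[[K LK] _ _ _] _] := aL; exists K => // g _.
  by apply/carrier_stab; exact: X1.
split; first by split=> [|H ->]; [exact: trivial_urs_is_urs|exact: amenable_trivial].
move=> L aL; exists trivial_sub, trivial_sub; split=> //.
have [three|X1] := dich; last first.
  have [[[K LK] _ _ _] _] := aL; suff <- : K = trivial_sub by [].
  apply: carrier_inj => g; have -> : g = 1%g by apply: faithful_a => z; exact: X1.
  by rewrite carrier_trivial; split=> // _; exact: carrier1.
apply: contrapT => nL.
have [V [oV V0 mV]] :=
  rist_mean_of_nontrivial_urs hausdorffX faithful_a boundary_a three aL nL.
have [x0 _] := three.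
have [x cx] := continuous_stab_exists a hausdorffX compactX countableG
  (ex_intro _ x0 I).
exact: (namx x) (amenable_stab_of_rist hausdorffX boundary_a oV V0 mV cx).
Qed.
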